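(* Let $X\in\mathcal B(H)$ be a self-adjoint operator on a Hilbert space $H$ and let $\mathcal A$ be the $C^*$-algebra generated by $X$. Then $G=\{X,X^2\}$ is a hyperrigid generator for $\mathcal A$.
   Context: The $C^*$-algebra generated by a set of operators is the smallest norm-closed $*$-subalgebra containing it (a unit is not adjoined). UCP means unit-preserving and completely positive. All representations of $C^*$-algebras on Hilbert spaces are assumed nondegenerate. A finite or countably infinite set $G$ of generators of a (not necessarily unital) $C^*$-algebra $A$ is called hyperrigid (a hyperrigid generator for $A$) if for every faithful (nondegenerate) representation of $A$ on a Hilbert space, written as an inclusion $A\subseteq\mathcal B(K)$, and every sequence of UCP maps $\phi_n:\mathcal B(K)\to\mathcal B(K)$, $n=1,2,\dots$, $$\lim_{n\to\infty}\|\phi_n(g)-g\|=0\ \ \forall g\in G\implies \lim_{n\to\infty}\|\phi_n(a)-a\|=0\ \ \forall a\in A.$$ *)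

(* Defs.v *)
From HB Require Import structures.
From mathcomp Require Import all_boot all_order all_algebra.
From mathcomp Require Import sesquilinear complex.
From mathcomp Require Import all_classical all_reals all_analysis.

Set Implicit Arguments.
Unset Strict Implicit.
Unset Printing Implicit Defensive.

Import Order.TTheory GRing.Theory Num.Theory.
Import numFieldNormedType.Exports.

Local Open Scope classical_set_scope.
Local Open Scope complex_scope.
Local Open Scope ring_scope.

(* The inner product is linear in its first argument and conjugate-linear in
   its second one. *)
Record hilbertSpace (R : realType) := HilbertSpace {
  hilbert_sort :> completeNormedModType R[i];
  inner : {dot hilbert_sort for @Num.conj R[i]};
  inner_norm : forall x : hilbert_sort, inner x x = `|x| ^+ 2 }.

Section BoundedOperators.
Context {K : numFieldType} {V : normedModType K}.

Definition bounded_linear (f : V -> V) : Prop :=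
  linear f /\ exists2 M : K, 0 <= M & forall x, `|f x| <= M * `|x|.

Definition bounded_linear_pred : {pred V -> V} :=
  [pred f | `[< bounded_linear f >]].

Record bop := Bop {
  bop_fun :> V -> V;
  _ : bop_fun \in bounded_linear_pred }.

HB.instance Definition _ := [isSub of bop for bop_fun].
HB.instance Definition _ := [Choice of bop by <:].

Lemma bopP (T : bop) : bounded_linear T.
Proof. exact/asboolP/(valP T). Qed.

Lemma bop_ext (S T : bop) : S =1 T -> S = T.
Proof. by move=> ST; apply/val_inj/funext. Qed.

Fact bounded_linear_submod : submod_closed bounded_linear_pred.
Proof.
split.
  apply/asboolP; split=> [a x y|] /=.
    by rewrite /= scaler0 addr0.
  by exists 0 => // x; rewrite normr0 mul0r.
move=> a f g /asboolP[lf [M M0 fM]] /asboolP[lg [N N0 gN]].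
apply/asboolP; split=> [b x y|].
  rewrite !fctE lf lg /= !scalerDr !scalerA mulrC -!addrA; congr (_ + _).
  by rewrite addrCA.
exists (`|a| * M + N); first by rewrite addr_ge0// mulr_ge0.
move=> x; rewrite !fctE (le_trans (ler_normD _ _))// mulrDl lerD//.
by rewrite normrZ -mulrA ler_wpM2l.
Qed.

HB.instance Definition _ :=
  GRing.isSubmodClosed.Build K (V -> V) bounded_linear_pred
    bounded_linear_submod.
HB.instance Definition _ := [SubChoice_isSubLmodule of bop by <:].

Fact bop_id_subproof : (idfun : V -> V) \in bounded_linear_pred.
Proof.
apply/asboolP; split=> //.
by exists 1 => // x; rewrite mul1r.
Qed.

Fact bop_comp_subproof (S T : bop) :
  (S \o T : V -> V) \in bounded_linear_pred.
Proof.
have [lS [M M0 SM]] := bopP S; have [lT [N N0 TN]] := bopP T.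
apply/asboolP; split=> [a x y|]; first by rewrite /= lT lS.
exists (M * N); first exact: mulr_ge0.
by move=> x /=; rewrite (le_trans (SM _))// -mulrA ler_wpM2l.
Qed.

Definition bop_id : bop := Bop bop_id_subproof.
Definition bop_comp (S T : bop) : bop := Bop (bop_comp_subproof S T).

Fact bop_linD (T : bop) (x y : V) : T (x + y) = T x + T y.
Proof. by have [lT _] := bopP T; have := lT 1 x y; rewrite !scale1r. Qed.

Fact bop_compA : associative bop_comp.
Proof. by move=> S T U; apply: bop_ext. Qed.
Fact bop_comp1l : left_id bop_id bop_comp.
Proof. by move=> S; apply: bop_ext. Qed.
Fact bop_comp1r : right_id bop_id bop_comp.
Proof. by move=> S; apply: bop_ext. Qed.
Fact bop_compDl : left_distributive bop_comp +%R.
Proof. by move=> S T U; apply: bop_ext. Qed.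
Fact bop_compDr : right_distributive bop_comp +%R.
Proof. by move=> S T U; apply: bop_ext => x; exact: bop_linD. Qed.

(* Only a pzRingType, because 1 = 0 when V is the zero space. *)
HB.instance Definition _ := GRing.Zmodule_isPzRing.Build bop
  bop_compA bop_comp1l bop_comp1r bop_compDl bop_compDr.

Fact bop_addE (S T : bop) (x : V) : (S + T) x = S x + T x.
Proof. by []. Qed.
Fact bop_oppE (T : bop) (x : V) : (- T) x = - T x.
Proof. by []. Qed.
Fact bop_scaleE (a : K) (T : bop) (x : V) : (a *: T) x = a *: T x.
Proof. by []. Qed.
Fact bop_mulE (S T : bop) (x : V) : (S * T) x = S (T x).
Proof. by []. Qed.
Fact bop_oneE (x : V) : (1 : bop) x = x.
Proof. by []. Qed.

End BoundedOperators.

Arguments bop {K} V.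
Arguments inner {R h}.

Section OperatorsOnHilbertSpaces.
Context {R : realType}.
Implicit Types H K : hilbertSpace R.

(* Norms of vectors are values in R[i], hence the real part. *)
Definition opnorm {H} (T : bop H) : R :=
  sup [set complex.Re `|T x| | x in [set x : H | `|x| <= 1]].

(* By the Riesz representation theorem each T has exactly one such S. *)
Definition is_adjoint {H} (T S : bop H) : Prop :=
  forall x y : H, inner (T x) y = inner x (S y).

Definition self_adjoint {H} (T : bop H) : Prop := is_adjoint T T.

Definition norm_closed {H} (A : set (bop H)) : Prop :=
  forall T, (forall e : R, 0 < e -> exists2 S, A S & opnorm (S - T) < e) -> A T.

Definition star_subalgebra {H} (A : set (bop H)) : Prop :=
  [/\ A 0,
      forall S T, A S -> A T -> A (S + T),
      forall (a : R[i]) T, A T -> A (a *: T),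
      forall S T, A S -> A T -> A (S * T) &
      forall S T, A S -> is_adjoint S T -> A T].

Definition cstar_generated {H} (G : set (bop H)) : set (bop H) :=
  smallest [set A | star_subalgebra A /\ norm_closed A] G.

(* A representation of a C*-algebra A of operators on H is a total function
   pi of which only the values on A are meaningful. *)
Definition representation {H K} (A : set (bop H)) (pi : bop H -> bop K) :
    Prop :=
  [/\ forall S T, A S -> A T -> pi (S + T) = pi S + pi T,
      forall (a : R[i]) T, A T -> pi (a *: T) = a *: pi T,
      forall S T, A S -> A T -> pi (S * T) = pi S * pi T &
      forall S T, A S -> A T -> is_adjoint S T -> is_adjoint (pi S) (pi T)].

Definition faithful {H K} (A : set (bop H)) (pi : bop H -> bop K) : Prop :=
  forall S T, A S -> A T -> pi S = pi T -> S = T.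

Definition nondegenerate {H K} (A : set (bop H)) (pi : bop H -> bop K) :
    Prop :=
  closure [set y : K | exists n (T : 'I_n -> bop H) (x : 'I_n -> K),
    (forall i, A (T i)) /\ y = \sum_(i < n) pi (T i) (x i)] = setT.

(* Positivity in M_n(B(K)) = B(K^n), with K^n the Hilbert direct sum. *)
Definition mx_positive {K} n (M : 'M[bop K]_n) : Prop :=
  forall x : 'I_n -> K,
    0 <= \sum_(i < n) \sum_(j < n) inner (M i j (x j)) (x i).

Definition completely_positive {K} (phi : bop K -> bop K) : Prop :=
  forall n (M : 'M[bop K]_n), mx_positive M -> mx_positive (map_mx phi M).

Definition ucp {K} (phi : {linear bop K -> bop K}) : Prop :=
  phi 1 = 1 /\ completely_positive phi.

Definition hyperrigid_generator {H} (A G : set (bop H)) : Prop :=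
  [/\ countable G,
      cstar_generated G = A &
      forall K (pi : bop H -> bop K),
        representation A pi -> faithful A pi -> nondegenerate A pi ->
        forall phi : nat -> {linear bop K -> bop K},
          (forall n, ucp (phi n)) ->
          (forall g, G g ->
            opnorm (phi n (pi g) - pi g) @[n --> \oo] --> (0 : R)) ->
          forall a, A a ->
            opnorm (phi n (pi a) - pi a) @[n --> \oo] --> (0 : R)].

End OperatorsOnHilbertSpaces.

(* Main.v *)
(* If phi is UCP, then (S, T) |-> phi(S^* T) - phi(S)^* phi(T) is a positive
   operator-valued form, so for Y self-adjoint the Cauchy-Schwarz inequality
   gives |phi(Y B) - phi(Y) phi(B)|^2 <= |B|^2 |phi(Y^2) - phi(Y)^2|.
   When phi_n(Y) -> Y and phi_n(Y^2) -> Y^2 the right-hand side tends to 0,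
   hence phi_n(Y B) - Y phi_n(B) -> 0 for every B.  The operators T such that
   phi_n(T B) - T phi_n(B) -> 0 for every B, and likewise for T^*, form a
   norm-closed star-subalgebra, hence contain the image of the whole algebra
   generated by X; B = 1 gives the conclusion.  Taking limits in the algebra
   requires its representation pi to be bounded: when a = T^* T has small norm
   it equals 2 b - b^2 for a self-adjoint b of the algebra, so that
   1 - pi(a) = (1 - pi(b))^2 is positive and |pi(T)| <= 1. *)

Require Import Defs.
From HB Require Import structures.
From mathcomp Require Import all_boot all_order all_algebra.
From mathcomp Require Import sesquilinear complex.
From mathcomp Require Import all_classical all_reals all_analysis.
From mathcomp Require Import ring lra.

Import Order.TTheory GRing.Theory Num.Theory.
Import numFieldNormedType.Exports.

Local Open Scope classical_set_scope.
Local Open Scope ring_scope.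

Set Implicit Arguments.
Unset Strict Implicit.
Unset Printing Implicit Defensive.

(** * Positive semidefinite sesquilinear forms *)

Section PositiveForms.
Variables (C : numClosedFieldType) (V : lmodType C) (F : V -> V -> C).
Hypothesis Fl : forall a u v w, F (a *: u + v) w = a * F u w + F v w.
Hypothesis Fr : forall a u v w, F w (a *: u + v) = a^* * F w u + F w v.
Hypothesis F_ge0 : forall u, 0 <= F u u.

Lemma form_expand (a : C) (u v : V) :
  F (a *: u + v) (a *: u + v) =
  a * a^* * F u u + a * F u v + a^* * F v u + F v v.
Proof. by rewrite Fl !Fr; ring. Qed.

(** Polarisation: positivity makes the diagonal values at [u + v] and ['i *: u + v] real. The first
    says that [F u v + F v u] is real, the second that [F u v - F v u] is purely imaginary. *)
Lemma form_conj (u v : V) : F v u = (F u v)^*.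
Proof.
have conjF w : (F w w)^* = F w w by apply: conj_Creal; exact: ger0_real.
have /= := conjF (1 *: u + v); have /= := conjF ('i *: u + v).
rewrite !form_expand !rmorphD !rmorphM /= !conjF conjCK conjCi rmorph1 !mul1r.
set x := F u v; set y := F v u => ei e1.
have ei' : y^* - x^* = x - y.
  apply: (mulfI (neq0Ci C)); apply/eqP; rewrite -subr_eq0; apply/eqP.
  by move/eqP: ei; rewrite -subr_eq0 => /eqP <-; ring.
have e1' : x^* + y^* = x + y.
  apply/eqP; rewrite -subr_eq0; apply/eqP.
  by move/eqP: e1; rewrite -subr_eq0 => /eqP <-; ring.
have two : 2 * y = 2 * x^*.
  have -> : 2 * y = x + y - (x - y) by ring.
  by rewrite -e1' -ei'; ring.
by apply: mulfI two; rewrite pnatr_eq0.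
Qed.

(** Evaluating the form at [- t * (F u v)^* *: u + v] gives a real quadratic polynomial in [t] that
    is nonnegative everywhere. *)
Lemma form_CauchySchwarz (u v : V) : `|F u v| ^+ 2 <= F u u * F v v.
Proof.
have key t : t \is Num.real ->
    0 <= t ^+ 2 * `|F u v| ^+ 2 * F u u - 2 * t * `|F u v| ^+ 2 + F v v.
  move=> tr; have := F_ge0 ((- t * (F u v)^*) *: u + v).
  rewrite form_expand (form_conj u v) rmorphM rmorphN /= conjCK (conj_Creal tr).
  by rewrite normCK; congr (0 <= _); ring.
have := F_ge0 u; rewrite le0r => /orP[/eqP u0|u_gt0].
  (* For [F u u = 0] the polynomial is affine in [t]; were its slope nonzero, this [t] would give it
     the value -1. *)
  rewrite u0 mul0r; have := key ((F v v + 1) / (2 * `|F u v| ^+ 2)).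
  have [->|N0] := eqVneq (F u v) 0; first by rewrite normr0 expr0n.
  have N2 : `|F u v| ^+ 2 != 0 by rewrite expf_neq0// normr_eq0.
  have -> : (F v v + 1) / (2 * `|F u v| ^+ 2) \is Num.real.
    by rewrite ger0_real// divr_ge0 ?(addr_ge0 (F_ge0 v))// mulr_ge0 ?exprn_ge0.
  move=> /(_ isT); rewrite u0 mulr0 add0r.
  set X := (X in 0 <= X); have -> : X = -1.
    by rewrite /X; field; rewrite normr_eq0.
  by rewrite oppr_ge0 ler10.
(* The quadratic polynomial is smallest at [t = 1 / F u u]. *)
have := key (F u u)^-1; rewrite ger0_real ?invr_ge0 ?F_ge0//.
move=> /(_ isT); set X := (X in 0 <= X).
have -> : X = F v v - `|F u v| ^+ 2 / F u u by rewrite /X; field; rewrite gt_eqF.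
by rewrite subr_ge0 ler_pdivrMr// mulrC.
Qed.

End PositiveForms.

(** * The operator norm and adjoints *)

Section OperatorNorm.
Context {R : realType}.
Implicit Types H K : hilbertSpace R.
Local Open Scope complex_scope.

Lemma innerPl H (a : R[i]) (u v w : H) :
  inner (a *: u + v) w = a * inner u w + inner v w.
Proof. exact: linearPl. Qed.

Lemma innerPr H (a : R[i]) (u v w : H) :
  inner w (a *: u + v) = Num.conj a * inner w u + inner w v.
Proof. exact: linearPr. Qed.

Lemma inner_ge0 H (u : H) : 0 <= inner u u.
Proof. by rewrite inner_norm exprn_ge0. Qed.

Lemma inner_conj H (u v : H) : inner v u = Num.conj (inner u v).
Proof.
by apply: (@form_conj _ _ (fun x y : H => inner x y) _ _ _ u v);
  [exact: innerPl|exact: innerPr|exact: inner_ge0].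
Qed.

Definition vnorm H (x : H) : R := complex.Re `|x|.

Lemma vnormE H (x : H) : `|x| = (vnorm x)%:C.
Proof. by rewrite RRe_real// ger0_real. Qed.

Lemma vnorm_ge0 H (x : H) : 0 <= vnorm x.
Proof. by rewrite -lecR -vnormE normr_ge0. Qed.

Lemma vnorm0 H : vnorm (0 : H) = 0.
Proof. by rewrite /vnorm normr0. Qed.

Lemma vnorm_eq0 H (x : H) : vnorm x = 0 -> x = 0.
Proof. by move=> x0; apply/normr0_eq0; rewrite vnormE x0. Qed.

Lemma vnorm_gt0 H (x : H) : x != 0 -> 0 < vnorm x.
Proof.
move=> x0; rewrite lt_neqAle vnorm_ge0 andbT eq_sym.
by apply: contra_neq x0; exact: vnorm_eq0.
Qed.

Lemma vnormD H (x y : H) : vnorm (x + y) <= vnorm x + vnorm y.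
Proof. by rewrite -lecR rmorphD /= -!vnormE ler_normD. Qed.

Lemma vnormN H (x : H) : vnorm (- x) = vnorm x.
Proof. by rewrite /vnorm normrN. Qed.

Lemma vnormZ H (a : R[i]) (x : H) : vnorm (a *: x) = complex.Re `|a| * vnorm x.
Proof.
by apply: complexI; rewrite rmorphM /= -!vnormE normrZ.
Qed.

Lemma vnormZr H (a : R) (x : H) : vnorm (a%:C *: x) = `|a| * vnorm x.
Proof.
rewrite vnormZ; congr (_ * _).
by rewrite normc_def /= expr0n addr0 sqrtr_sqr.
Qed.

Lemma vnorm_inner H (x : H) : inner x x = (vnorm x ^+ 2)%:C.
Proof. by rewrite inner_norm vnormE rmorphXn. Qed.

Lemma inner_CauchySchwarz H (x y : H) :
  `|inner x y| <= (vnorm x * vnorm y)%:C.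
Proof.
rewrite -ler_sqr ?nnegrE//; last by rewrite ler0c mulr_ge0 ?vnorm_ge0.
have -> : (vnorm x * vnorm y)%:C ^+ 2 = inner x x * inner y y.
  by rewrite !vnorm_inner -rmorphM -rmorphXn exprMn.
by apply: (@form_CauchySchwarz _ _ (fun x y : H => inner x y));
  [exact: innerPl|exact: innerPr|exact: inner_ge0].
Qed.

Lemma inner_inj H (x y : H) : (forall z, inner z x = inner z y) -> x = y.
Proof.
move=> xy; apply/eqP; rewrite -subr_eq0; apply/eqP/vnorm_eq0/eqP.
have : inner (x - y) (x - y) = 0 by rewrite linearBr /= !xy subrr.
by rewrite vnorm_inner => /complexI/eqP; rewrite expf_eq0.
Qed.

Lemma bop0 H (T : bop H) : T 0 = 0.
Proof. by apply: (addrI (T 0)); rewrite -bop_linD !addr0. Qed.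

Lemma bopZ H (T : bop H) (a : R[i]) (x : H) : T (a *: x) = a *: T x.
Proof. by have [lT _] := bopP T; have := lT a x 0; rewrite bop0 !addr0. Qed.

Lemma bopN H (T : bop H) (x : H) : T (- x) = - T x.
Proof. by rewrite -scaleN1r bopZ scaleN1r. Qed.

Lemma opnorm_has_ubound H (T : bop H) :
  has_ubound [set complex.Re `|T x| | x in [set x : H | `|x| <= 1]].
Proof.
have [lT [M M0 TM]] := bopP T.
have Mr : M = (complex.Re M)%:C by rewrite RRe_real// ger0_real.
exists (complex.Re M) => _ [y /= y1 <-].
rewrite -lecR -Mr -vnormE (le_trans (TM y))//.
by rewrite -[leRHS]mulr1 ler_wpM2l.
Qed.

Lemma vnorm_opnorm H (T : bop H) (x : H) : vnorm (T x) <= opnorm T * vnorm x.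
Proof.
have [->|x0] := eqVneq x 0; first by rewrite bop0 !vnorm0 mulr0.
have nx0 := vnorm_gt0 x0.
rewrite -ler_pdivrMr// mulrC; apply: ub_le_sup; first exact: opnorm_has_ubound.
exists ((vnorm x)^-1%:C *: x) => /=.
  by rewrite vnormE vnormZr ger0_norm ?invr_ge0 ?vnorm_ge0// mulVf ?gt_eqF.
by rewrite bopZ -/(vnorm _) vnormZr ger0_norm ?invr_ge0 ?vnorm_ge0.
Qed.

Lemma opnorm_le H (T : bop H) (c : R) : 0 <= c ->
  (forall x, vnorm (T x) <= c * vnorm x) -> opnorm T <= c.
Proof.
move=> c0 Tc; apply: ge_sup.
  by exists (complex.Re `|T 0|); exists 0 => //=; rewrite normr0 ler01.
move=> _ [x /= x1 <-]; rewrite -/(vnorm _) (le_trans (Tc x))//.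
by rewrite -[leRHS]mulr1 ler_wpM2l// -lecR -vnormE.
Qed.

Lemma opnorm_ge0 H (T : bop H) : 0 <= opnorm T.
Proof.
apply: ub_le_sup; first exact: opnorm_has_ubound.
by exists 0; rewrite /= ?normr0 ?ler01// bop0 normr0.
Qed.

Lemma opnormD H (S T : bop H) : opnorm (S + T) <= opnorm S + opnorm T.
Proof.
apply: opnorm_le => [|x]; first by rewrite addr_ge0 ?opnorm_ge0.
by rewrite bop_addE (le_trans (vnormD _ _))// mulrDl lerD ?vnorm_opnorm.
Qed.

Lemma opnormM H (S T : bop H) : opnorm (S * T) <= opnorm S * opnorm T.
Proof.
apply: opnorm_le => [|x]; first by rewrite mulr_ge0 ?opnorm_ge0 ?normr_ge0.
by rewrite bop_mulE (le_trans (vnorm_opnorm _ _))// -mulrA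
  ler_wpM2l ?opnorm_ge0 ?vnorm_opnorm.
Qed.

Lemma opnormZ H (a : R[i]) (T : bop H) :
  opnorm (a *: T) <= complex.Re `|a| * opnorm T.
Proof.
have a0 : 0 <= complex.Re `|a| by rewrite normc_def sqrtr_ge0.
apply: opnorm_le => [|x]; first by rewrite mulr_ge0 ?opnorm_ge0 ?normr_ge0.
by rewrite bop_scaleE vnormZ -mulrA ler_wpM2l ?vnorm_opnorm.
Qed.

Lemma opnormZr H (a : R) (T : bop H) : opnorm (a%:C *: T) <= `|a| * opnorm T.
Proof.
apply: opnorm_le => [|x]; first by rewrite mulr_ge0 ?opnorm_ge0 ?normr_ge0.
by rewrite bop_scaleE vnormZr -mulrA ler_wpM2l ?vnorm_opnorm.
Qed.

Lemma opnorm0 H : opnorm (0 : bop H) = 0.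
Proof.
apply/le_anti; rewrite opnorm_ge0 andbT opnorm_le// => x.
by rewrite vnorm0 mul0r.
Qed.

Lemma opnormN H (T : bop H) : opnorm (- T) = opnorm T.
Proof.
have leN (S : bop H) : opnorm (- S) <= opnorm S.
  by apply: opnorm_le => [|x]; rewrite ?opnorm_ge0// bop_oppE vnormN vnorm_opnorm.
by apply/le_anti; rewrite leN -[X in opnorm X <= _]opprK leN.
Qed.

Lemma opnormBC H (S T : bop H) : opnorm (S - T) = opnorm (T - S).
Proof. by rewrite -opnormN opprB. Qed.

Lemma opnorm_eq0 H (T : bop H) : (forall e, 0 < e -> opnorm T <= e) -> T = 0.
Proof.
move=> Te; have T0 : opnorm T <= 0 by apply/ler_addgt0Pr => e e0; rewrite add0r Te.
apply: bop_ext => x; apply/vnorm_eq0/le_anti; rewrite vnorm_ge0 andbT.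
by rewrite (le_trans (vnorm_opnorm T x))// mulr_le0_ge0 ?vnorm_ge0.
Qed.

Lemma is_adjoint_sym H (S T : bop H) : is_adjoint S T -> is_adjoint T S.
Proof. by move=> ST x y; rewrite inner_conj -ST -inner_conj. Qed.

Lemma is_adjoint_unique H (S T T' : bop H) :
  is_adjoint S T -> is_adjoint S T' -> T = T'.
Proof.
by move=> ST ST'; apply: bop_ext => y; apply: inner_inj => x; rewrite -ST -ST'.
Qed.

Lemma is_adjoint0 H : is_adjoint (0 : bop H) 0.
Proof. by move=> x y; rewrite linear0l linear0r. Qed.

Lemma is_adjoint1 H : is_adjoint (1 : bop H) 1.
Proof. by []. Qed.

Lemma is_adjointD H (S S' T T' : bop H) :
  is_adjoint S S' -> is_adjoint T T' -> is_adjoint (S + T) (S' + T').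
Proof. by move=> SS TT x y; rewrite !bop_addE linearDl linearDr /= SS TT. Qed.

Lemma is_adjointZ H (a : R[i]) (S S' : bop H) :
  is_adjoint S S' -> is_adjoint (a *: S) (Num.conj a *: S').
Proof.
move=> SS x y; rewrite !bop_scaleE.
by rewrite linearZl_LR linearZr_LR /= SS conjCK.
Qed.

Lemma is_adjointB H (S S' T T' : bop H) :
  is_adjoint S S' -> is_adjoint T T' -> is_adjoint (S - T) (S' - T').
Proof.
by move=> SS TT x y; rewrite !bop_addE !bop_oppE linearBl linearBr /= SS TT.
Qed.

Lemma is_adjointM H (S S' T T' : bop H) :
  is_adjoint S S' -> is_adjoint T T' -> is_adjoint (S * T) (T' * S').
Proof. by move=> SS TT x y; rewrite !bop_mulE SS TT. Qed.

(** Cauchy-Schwarz in |T y|^2 = <S (T y), y> <= |S| |T y| |y|, then division by |T y|. *)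
Lemma opnorm_adjoint H (S T : bop H) : is_adjoint S T -> opnorm T <= opnorm S.
Proof.
move=> ST; apply: opnorm_le => [|y]; first exact: opnorm_ge0.
have [->|Ty0] := eqVneq (T y) 0.
  by rewrite vnorm0 mulr_ge0 ?opnorm_ge0 ?vnorm_ge0.
have Ty_gt0 := vnorm_gt0 Ty0.
rewrite -(ler_pM2l Ty_gt0) -expr2 -lecR -vnorm_inner -ST.
apply: le_trans (real_ler_norm _) _.
  by rewrite ST vnorm_inner; apply/complex_realP; eexists.
apply: le_trans (inner_CauchySchwarz _ _) _.
by rewrite lecR mulrCA mulrA ler_wpM2r ?vnorm_ge0 ?vnorm_opnorm.
Qed.

End OperatorNorm.

(** * Completeness of the space of bounded operators *)

Section Completeness.
Context {R : realType}.
Implicit Types H K : hilbertSpace R.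
Local Open Scope complex_scope.

Definition op_cvg H (f : nat -> bop H) (g : bop H) :=
  forall e : R, 0 < e -> exists N, forall n, (N <= n)%N -> opnorm (f n - g) <= e.

(** The limit is taken pointwise by completeness of [H]; the Cauchy estimate is uniform on the unit
    ball and survives the passage to the limit. *)
Lemma bop_complete H (f : nat -> bop H) :
  (forall e : R, 0 < e -> exists N, forall m n, (N <= m)%N -> (N <= n)%N ->
     opnorm (f m - f n) <= e) ->
  exists g, op_cvg f g.
Proof.
move=> f_cauchy.
have fx_cvg x : exists y : H, f n x @[n --> \oo] --> y.
  suff /cauchy_cvgP fc : cauchy (f n x @[n --> \oo])
    by exists (lim (f n x @[n --> \oo])).
  apply: cauchy_exP => e e_gt0C.
  have er : e = (complex.Re e)%:C by rewrite RRe_real// gtr0_real.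
  have e_gt0 : 0 < complex.Re e by rewrite -ltcR -er.
  (* Adding 1 keeps the divisor positive when [x = 0]. *)
  have x1_gt0 : 0 < vnorm x + 1 by rewrite ltr_wpDl ?vnorm_ge0.
  have [N fN] := f_cauchy _ (divr_gt0 e_gt0 x1_gt0).
  exists (f N x); exists N => // n /= Nn; rewrite -ball_normE /ball_ /=.
  rewrite vnormE er ltcR -bop_oppE -bop_addE.
  rewrite (le_lt_trans (vnorm_opnorm _ _))//.
  rewrite (le_lt_trans (ler_wpM2r (vnorm_ge0 x) (fN _ _ (leqnn N) Nn)))//.
  by rewrite mulrAC ltr_pdivrMr// ltr_pM2l// ltrDl.
have [g fg] := choice fx_cvg.
have g_lin : linear g.
  move=> a x y; apply: (norm_cvg_unique (fg (a *: x + y))).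
  rewrite (_ : (fun n => f n _) = (fun n => a *: f n x + f n y)); last first.
    by apply/funext => n; rewrite bop_linD bopZ.
  by apply: cvgD (fg y); apply: cvgZ (fg x); exact: cvg_cst.
(* [N] must not depend on [x]. The index [M] below does, but it occurs only in an intermediate term
   whose error [d] is arbitrary. *)
have fg_bound (e : R) : 0 < e -> exists N, forall n x, (N <= n)%N ->
    vnorm (f n x - g x) <= e * vnorm x.
  move=> e0; have [N fN] := f_cauchy e e0; exists N => n x Nn.
  apply/ler_addgt0Pr => d d0.
  have [M _ /(_ (maxn M N) (leq_maxl _ _))] :
      \forall n \near \oo, `|g x - f n x| < d%:C.
    by move/cvgrPdist_lt : (fg x); apply; rewrite ltcR.
  rewrite /= vnormE ltcR => /ltW gd.
  rewrite -(subrKA (f (maxn M N) x)) (le_trans (vnormD _ _))// lerD//.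
    rewrite -bop_oppE -bop_addE (le_trans (vnorm_opnorm _ _))//.
    by rewrite ler_wpM2r ?vnorm_ge0// fN// leq_maxr.
  by rewrite -vnormN opprB.
have gP : bounded_linear g.
  split=> //; have [N fN] := fg_bound 1 ltr01.
  exists (opnorm (f N) + 1)%:C; first by rewrite ler0c addr_ge0 ?opnorm_ge0.
  move=> x; rewrite !vnormE -rmorphM lecR mulrDl.
  rewrite -[g x](subrK (f N x)) addrC.
  rewrite (le_trans (vnormD _ _))// lerD ?vnorm_opnorm//.
  by rewrite -vnormN opprB fN.
exists (Bop (asboolT gP)) => e e0; have [N fN] := fg_bound e e0.
by exists N => n Nn; apply: opnorm_le => [|x]; [exact: ltW|exact: fN].
Qed.

End Completeness.

(** * C*-algebras and their representations *)

Section CstarAlgebras.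
Context {R : realType}.
Implicit Types H K : hilbertSpace R.
Local Open Scope complex_scope.

Lemma bop_scaleAl H (a : R[i]) (S T : bop H) : (a *: S) * T = a *: (S * T).
Proof. exact: bop_ext. Qed.

Lemma is_adjoint_lim H (f f' : nat -> bop H) (g g' : bop H) :
  (forall n, is_adjoint (f n) (f' n)) -> op_cvg f g -> op_cvg f' g' ->
  is_adjoint g g'.
Proof.
move=> ff' fg fg' x y; apply/eqP; rewrite -subr_eq0 -normr_eq0.
have N0 : `|inner (g x) y - inner x (g' y)| <= 0%:C.
  have /complex_realP[r rE] := normr_real (inner (g x) y - inner x (g' y)).
  rewrite rE lecR; apply/ler_addgt0Pr => e e0; rewrite add0r.
  set c := vnorm x * vnorm y.
  have c0 : 0 < 2 * c + 1.
    by rewrite ltr_wpDl// mulr_ge0// mulr_ge0 ?vnorm_ge0.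
  have [N fN] := fg _ (divr_gt0 e0 c0).
  have [N' fN'] := fg' _ (divr_gt0 e0 c0).
  set n := maxn N N'; have Nn : (N <= n)%N := leq_maxl _ _.
  have N'n : (N' <= n)%N := leq_maxr _ _.
  rewrite -lecR -rE.
  (* The terms in [f n] and [f' n] cancel by adjointness, leaving two errors, each at most
     [c * e / (2 * c + 1)]. *)
  have -> : inner (g x) y - inner x (g' y) =
      inner x ((f' n - g') y) - inner ((f n - g) x) y.
    rewrite !bop_addE !bop_oppE linearDl linearDr linearNl linearNr /= ff'.
    by ring.
  rewrite (le_trans (ler_normB _ _))//.
  rewrite (le_trans (lerD (inner_CauchySchwarz _ _) (inner_CauchySchwarz _ _)))//.
  rewrite -rmorphD lecR; apply: (@le_trans _ _ (e / (2 * c + 1) * (2 * c))).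
    rewrite (_ : _ * (2 * c) = vnorm x * (e / (2 * c + 1) * vnorm y) +
      e / (2 * c + 1) * vnorm x * vnorm y); last by rewrite /c; ring.
    rewrite lerD// ?ler_wpM2l ?ler_wpM2r ?vnorm_ge0//;
      rewrite (le_trans (vnorm_opnorm _ _))// ler_wpM2r ?vnorm_ge0//.
      exact: fN'.
    exact: fN.
  by rewrite mulrAC ler_pdivrMr// ler_wpM2l ?lerDl// ltW.
by rewrite eq_le N0 normr_ge0.
Qed.

Lemma star_subalgebra_generated H (G : set (bop H)) :
  star_subalgebra (cstar_generated G).
Proof.
split=> [|S T AS AT|a T AT|S T AS AT|S T AS ST] B BG;
  have [[B0 BD BZ BM BS] _] := BG.1.
- exact: B0.
- by apply: BD; [exact: AS|exact: AT].
- by apply: BZ; exact: AT.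
- by apply: BM; [exact: AS|exact: AT].
- by apply: BS ST; exact: AS.
Qed.

Lemma norm_closed_generated H (G : set (bop H)) :
  norm_closed (cstar_generated G).
Proof.
move=> T cT B BG; have [[_ Bcl] _] := BG; apply: Bcl => e e0.
by have [S AS eS] := cT e e0; exists S => //; exact: AS.
Qed.

Lemma norm_closed_lim H (A : set (bop H)) (f : nat -> bop H) (g : bop H) :
  norm_closed A -> (forall n, A (f n)) -> op_cvg f g -> A g.
Proof.
move=> Acl Af fg; apply: Acl => e e0.
have [N fN] := fg _ (divr_gt0 e0 (ltr0Sn R 1)).
exists (f N) => //; rewrite (le_lt_trans (fN N _))// ltr_pdivrMr//.
by rewrite ltr_pMr// ltr1n.
Qed.

(** Instead of the Riesz theorem: the operators that have an adjoint form a norm-closed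
    star-subalgebra containing [G]. For closedness, passing to adjoints does not increase the norm,
    so the adjoints of a convergent sequence are Cauchy. *)
Lemma adjointable_generated H (G : set (bop H)) :
  (forall T, G T -> self_adjoint T) ->
  forall T, cstar_generated G T -> exists S, is_adjoint T S.
Proof.
move=> Gsa T AT; apply: (AT [set T | exists S, is_adjoint T S]).
split=> [|S /Gsa]; last by exists S.
move: T {AT} => _; split=> [|T cT].
  split=> [|S T' [S' SS] [T'' TT]|a T' [S TS]|S T' [S' SS] [T'' TT]|S T' _ ST].
  - by exists 0; exact: is_adjoint0.
  - by exists (S' + T''); exact: is_adjointD.
  - by exists (Num.conj a *: S); exact: is_adjointZ.
  - by exists (T'' * S'); exact: is_adjointM.
  - by exists S; exact: is_adjoint_sym.
have /choice[f fP] : forall n, exists ST : bop H * bop H,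
    is_adjoint ST.1 ST.2 /\ opnorm (ST.1 - T) < n.+1%:R^-1.
  move=> n; have [S [S' SS] ST] := cT n.+1%:R^-1 ltac:(by []).
  by exists (S, S').
have f1 : op_cvg (fun n => (f n).1) T.
  move=> e e0; have [N] := ltr_add_invr e0; rewrite add0r => Ne.
  exists N => n Nn; apply/ltW/(lt_trans (fP n).2)/(le_lt_trans _ Ne).
  by rewrite lef_pV2 ?posrE// ler_nat.
have [|g fg] := @bop_complete _ _ (fun n => (f n).2).
  move=> e e0; have [N fN] := f1 _ (divr_gt0 e0 (ltr0Sn R 1)).
  exists N => m n Nm Nn.
  apply: (@le_trans _ _ (opnorm ((f m).1 - (f n).1))).
    by apply: opnorm_adjoint; apply: is_adjointB (fP m).1 (fP n).1.
  rewrite -(subrKA T) (le_trans (opnormD _ _))// [leRHS]splitr lerD ?fN//.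
  by rewrite opnormBC fN.
by exists g; apply: is_adjoint_lim f1 fg => n; exact: (fP n).1.
Qed.

Lemma star_subalgebraB H (A : set (bop H)) (S T : bop H) :
  star_subalgebra A -> A S -> A T -> A (S - T).
Proof.
by move=> [_ AD AZ _ _] AS AT; rewrite -scaleN1r; apply: AD => //; exact: AZ.
Qed.

Lemma representationB H K (A : set (bop H)) (pi : bop H -> bop K) (S T : bop H) :
  star_subalgebra A -> representation A pi -> A S -> A T ->
  pi (S - T) = pi S - pi T.
Proof.
move=> [_ AD AZ _ _] [piD piZ _ _] AS AT.
have AT1 : A (-1 *: T) by exact: AZ.
by rewrite -scaleN1r piD// piZ// scaleN1r.
Qed.

Lemma opnorm_sqrB H (S T : bop H) :
  opnorm (S * S - T * T) <= (opnorm S + opnorm T) * opnorm (S - T).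
Proof.
have -> : S * S - T * T = S * (S - T) + (S - T) * T.
  by rewrite mulrBr mulrBl addrA subrK.
rewrite (le_trans (opnormD _ _))// [leRHS]mulrDl lerD ?opnormM//.
by rewrite mulrC opnormM.
Qed.

(* [1 - b] is a square root of [1 - a]; writing it through [b] keeps the
   construction inside the possibly non-unital algebra. *)
Lemma quasi_sqrt H (A : set (bop H)) (a : bop H) :
  star_subalgebra A -> norm_closed A ->
  A a -> self_adjoint a -> opnorm a <= 3 / 4 ->
  exists b, [/\ A b, self_adjoint b & a = b + b - b * b].
Proof.
move=> [A0 AD AZ AM _] Acl Aa asa a34.
(* A fixed point of [step] solves [a = b + b - b * b]; the iteration starts at 0 and never leaves
   [A]. *)
pose step b : bop H := 2^-1%:C *: (a + b * b).
pose f n := iter n step 0.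
have fS n : f n.+1 = step (f n) by [].
have Af n : A (f n).
  by elim: n => //= n IHn; apply: AZ; apply: AD => //; exact: AM.
have fsa n : self_adjoint (f n).
  elim: n => [|n IHn]; first exact: is_adjoint0.
  have := is_adjointZ (2^-1)%:C (is_adjointD asa (is_adjointM IHn IHn)).
  by rewrite [Num.conj _]conjc_real.
(* The ball of radius 1/2 is invariant because (3/4 + 1/4) / 2 = 1/2. *)
have f12 n : opnorm (f n) <= 2^-1.
  elim: n => [|n IHn]; first by rewrite opnorm0 invr_ge0.
  rewrite fS (le_trans (opnormZr _ _))// ger0_norm ?invr_ge0//.
  have : opnorm (a + f n * f n) <= 3 / 4 + 2^-1 * 2^-1.
    rewrite (le_trans (opnormD _ _))// lerD// (le_trans (opnormM _ _))//.
    by rewrite ler_pM ?opnorm_ge0.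
  by lra.
(* On that ball |S^2 - T^2| <= |S - T| by [opnorm_sqrB], so [step] contracts distances by the factor
   1/2. *)
have fB n m k : opnorm (f (n + m)%N - f (n + k)%N) <= 2^-1 ^+ n.
  elim: n => [|n IHn].
    rewrite expr0 (le_trans (opnormD _ _))// opnormN.
    by have := f12 m; have := f12 k; rewrite !add0n; lra.
  rewrite !addSn !fS /step -scalerBr (le_trans (opnormZr _ _))//.
  rewrite ger0_norm ?invr_ge0// exprS ler_wpM2l ?invr_ge0//.
  rewrite [X in opnorm X](_ : _ = f (n + m)%N * f (n + m)%N -
    f (n + k)%N * f (n + k)%N); last by rewrite opprD addrACA subrr add0r.
  rewrite (le_trans (opnorm_sqrB _ _))// (le_trans _ IHn)//.
  rewrite -[leRHS]mul1r ler_wpM2r ?opnorm_ge0//.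
  by have := f12 (n + m)%N; have := f12 (n + k)%N; lra.
have [|b fb] := @bop_complete _ _ f.
  move=> e e0; have [N] := ltr_add_invr e0; rewrite add0r => Ne.
  exists N.+1 => m n Nm Nn; rewrite -(subnKC Nm) -(subnKC Nn).
  rewrite (le_trans (fB _ _ _))// (le_trans _ (ltW Ne))// exprVn.
  by rewrite lef_pV2 ?posrE ?exprn_gt0// -natrX ler_nat ltnW// ltn_expl.
exists b; split.
- exact: norm_closed_lim fb.
- exact: (is_adjoint_lim fsa fb fb).
have nb0 := opnorm_ge0 b.
apply/eqP; rewrite -subr_eq0; apply/eqP/opnorm_eq0 => e e0.
have b3_gt0 : 0 < opnorm b + 3 by lra.
have [N fN] := fb _ (divr_gt0 e0 b3_gt0).
have aE : a = f N.+1 + f N.+1 - f N * f N.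
  have half : 2^-1 + 2^-1 = 1 :> R by lra.
  by rewrite fS /step -scalerDl -rmorphD half scale1r addrK.
rewrite {1}aE [X in opnorm X](_ : _ = (f N.+1 - b) + (f N.+1 - b) -
  (f N * f N - b * b)); last first.
  rewrite [in LHS]opprD opprK addrACA.
  rewrite [in RHS]opprB [in RHS](addrACA (f N.+1)) -opprD.
  by rewrite [- _ + b * b]addrC.
set d := e / (opnorm b + 3).
(* The two copies of [f N.+1 - b] cost [d] each, and the difference of squares costs at most (1/2 +
   |b|) d; hence the 3 in [d]. *)
have -> : e = d + d + (opnorm b + 1) * d by rewrite /d; field; rewrite gt_eqF.
have d0 : 0 <= d by rewrite ltW// divr_gt0.
rewrite (le_trans (opnormD _ _))// opnormN lerD//.
  by rewrite (le_trans (opnormD _ _))// lerD// fN.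
rewrite (le_trans (opnorm_sqrB _ _))// ler_pM ?addr_ge0 ?opnorm_ge0 ?fN//.
by rewrite addrC lerD// (le_trans (f12 N))//; lra.
Qed.

(** The factor 2 comes from rescaling [T] to norm at most 1/2, where T^* T has norm at most 1/4 and
    [quasi_sqrt] applies. Taking [c] positive rather than the norm itself covers [T = 0]. *)
Lemma opnorm_representation H K (A : set (bop H)) (pi : bop H -> bop K) :
  star_subalgebra A -> norm_closed A ->
  (forall T, A T -> exists S, is_adjoint T S) -> representation A pi ->
  forall T (c : R), A T -> 0 < c -> opnorm T <= c -> opnorm (pi T) <= 2 * c.
Proof.
move=> sA Acl Aadj pi_rep T c AT c0 Tc; have [piD piZ piM pistar] := pi_rep.
have [A0 AD AZ AM AS] := sA.
have contr U : A U -> opnorm U <= 2^-1 -> opnorm (pi U) <= 1.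
  move=> AU U12; have [V UV] := Aadj U AU; have AV := AS _ _ AU UV.
  have [||b [Ab bsa bE]] := quasi_sqrt sA Acl (AM _ _ AV AU).
  - exact: is_adjointM (is_adjoint_sym UV) UV.
  - rewrite (le_trans (opnormM _ _))//.
    have := opnorm_adjoint UV; have := opnorm_ge0 U; have := opnorm_ge0 V.
    by move: (opnorm U) (opnorm V) U12 => u v; nra.
  have Pb := pistar _ _ Ab Ab bsa.
  have PUV := pistar _ _ AU AV UV.
  apply: opnorm_le => // x; rewrite mul1r -ler_sqr ?nnegrE ?vnorm_ge0// -lecR.
  rewrite -!vnorm_inner PUV -bop_mulE -piM// bE.
  rewrite (representationB sA pi_rep) ?piD ?piM//; [|exact: AD|exact: AM].
  set P := pi b; rewrite -subr_ge0.
  (* Here 1 - pi(U^* U) = (1 - P)^2 with [P] self-adjoint. *)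
  have -> : inner x x - inner x ((P + P - P * P) x) = inner (x - P x) (x - P x).
    rewrite !bop_addE bop_oppE bop_mulE linearBl /= !linearBr /= !linearDr /=.
    by rewrite !Pb; ring.
  exact: inner_ge0.
have -> : T = (2 * c)%:C *: ((2 * c)^-1%:C *: T).
  by rewrite scalerA -rmorphM divff ?scale1r// mulf_neq0// gt_eqF.
rewrite piZ; last exact: AZ.
rewrite (le_trans (opnormZr _ _))// ger0_norm; last by rewrite mulr_ge0// ltW.
rewrite -[leRHS]mulr1 ler_wpM2l ?mulr_ge0 ?(ltW c0)//.
apply: contr; first exact: AZ.
rewrite (le_trans (opnormZr _ _))// ger0_norm ?invr_ge0 ?mulr_ge0 ?(ltW c0)//.
by rewrite ler_pdivrMl ?mulr_gt0// mulrAC mulfV// mul1r.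
Qed.

End CstarAlgebras.

(** * Unital completely positive maps *)

Section UCPMaps.
Context {R : realType}.
Variables (K : hilbertSpace R) (phi : {linear bop K -> bop K}).
Hypothesis phi_ucp : ucp phi.
Local Open Scope complex_scope.

Section GramForm.
Variables (n : nat) (A A' : 'I_n -> bop K).
Hypothesis AA' : forall i, is_adjoint (A i) (A' i).

(** Stinespring's semi-inner product of the sums of the tensors A_j (x) x_j and A_i (x) y_i, where
    [A' i] is the adjoint of [A i]. *)
Definition gram_form (x y : 'I_n -> K) : R[i] :=
  \sum_(i < n) \sum_(j < n) inner (phi (A' i * A j) (x j)) (y i).

Lemma gram_formPl a u v w :
  gram_form (a *: u + v) w = a * gram_form u w + gram_form v w.
Proof.
rewrite /gram_form mulr_sumr -big_split; apply: eq_bigr => i _ /=.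
rewrite mulr_sumr -big_split; apply: eq_bigr => j _ /=.
by rewrite bop_linD bopZ innerPl.
Qed.

Lemma gram_formPr a u v w :
  gram_form w (a *: u + v) = Num.conj a * gram_form w u + gram_form w v.
Proof.
rewrite /gram_form mulr_sumr -big_split; apply: eq_bigr => i _ /=.
rewrite mulr_sumr -big_split; apply: eq_bigr => j _ /=.
exact: innerPr.
Qed.

(** The matrix of the products A_i^* A_j is positive, since its form at [x] is the squared norm of
    the sum of the A_j x_j; complete positivity carries this over to [phi]. *)
Lemma gram_form_ge0 u : 0 <= gram_form u u.
Proof.
have /(phi_ucp.2 n) /(_ u) : mx_positive (\matrix_(i, j) (A' i * A j)).
  move=> x; rewrite [leRHS](_ : _ =
    inner (\sum_j A j (x j)) (\sum_i A i (x i))); first exact: inner_ge0.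
  rewrite linear_sumr; apply: eq_bigr => i _; rewrite linear_sumlz.
  by apply: eq_bigr => j _; rewrite mxE (is_adjoint_sym (AA' i)).
rewrite [X in _ <= X -> _](_ : _ = gram_form u u)//.
by apply: eq_bigr => i _; apply: eq_bigr => j _; rewrite !mxE.
Qed.

Lemma gram_form_conj u v : gram_form v u = Num.conj (gram_form u v).
Proof.
exact: (@form_conj R[i] _ _ gram_formPl gram_formPr gram_form_ge0).
Qed.

Lemma gram_form_CauchySchwarz u v :
  `|gram_form u v| ^+ 2 <= gram_form u u * gram_form v v.
Proof.
exact: (@form_CauchySchwarz R[i] _ _ gram_formPl gram_formPr gram_form_ge0).
Qed.

End GramForm.

(** Hermitian symmetry of the Gram form of [1, B] at the vectors [(0, x)] and [(y, 0)]. *)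
Lemma ucp_adjoint B B' : is_adjoint B B' -> is_adjoint (phi B) (phi B').
Proof.
move=> BB' x y.
have AA' (i : 'I_2) : is_adjoint (nth 0 [:: 1; B] i) (nth 0 [:: 1; B'] i).
  by case: i => -[|[|]].
have := gram_form_conj AA' (fun i => nth 0 [:: 0; x] i)
  (fun i => nth 0 [:: y; 0] i).
rewrite /gram_form !big_ord_recl !big_ord0 /= !bop0 !linear0l !linear0r.
rewrite !addr0 !add0r mulr1 mul1r => h.
by rewrite [RHS]inner_conj h conjCK.
Qed.

(** The Kadison-Schwarz inequality. The Gram form of [1, B] at [(- phi B x, x)] is exactly the
    difference of the two sides. *)
Lemma ucp_Schwarz B B' : is_adjoint B B' ->
  forall x, inner (phi B x) (phi B x) <= inner (phi (B' * B) x) x.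
Proof.
move=> BB' x.
have AA' (i : 'I_2) : is_adjoint (nth 0 [:: 1; B] i) (nth 0 [:: 1; B'] i).
  by case: i => -[|[|]].
have := gram_form_ge0 AA' (fun i => nth 0 [:: - phi B x; x] i).
rewrite /gram_form !big_ord_recl !big_ord0 /= !addr0 mulr1 !mul1r mulr1 phi_ucp.1.
rewrite bop_oneE !bopN !linearNl !linearNr /= (ucp_adjoint (is_adjoint_sym BB')).
by rewrite -subr_ge0; congr (0 <= _); ring.
Qed.

(** The operator |B|^2 1 - B^* B is positive, and [phi] is unital and preserves positivity (matrices
    of size 1). *)
Lemma ucp_gram_le B B' : is_adjoint B B' ->
  forall x, inner (phi (B' * B) x) x <= ((opnorm B * vnorm x) ^+ 2)%:C.
Proof.
move=> BB' x; have nB := opnorm_ge0 B.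
have /(phi_ucp.2 1) /(_ (fun=> x)) :
    mx_positive (const_mx ((opnorm B ^+ 2)%:C *: (1 : bop K) - B' * B : bop K)
      : 'M[bop K]_1).
  move=> y; rewrite !big_ord1 mxE bop_addE bop_oppE bop_scaleE bop_oneE bop_mulE.
  rewrite linearBl linearZl_LR /= (is_adjoint_sym BB') !vnorm_inner -rmorphM.
  rewrite subr_ge0 lecR -exprMn ler_sqr ?nnegrE ?mulr_ge0 ?vnorm_ge0//.
  exact: vnorm_opnorm.
rewrite !big_ord1 !mxE linearB linearZ /= phi_ucp.1.
rewrite [X in 0 <= inner X _](_ : _ =
  (opnorm B ^+ 2)%:C *: x - phi (B' * B) x)//.
rewrite linearBl linearZl_LR /= subr_ge0.
by rewrite vnorm_inner -[_%:C * _](rmorphM (real_complex R)) -exprMn.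
Qed.

Lemma ucp_contractive B B' : is_adjoint B B' -> opnorm (phi B) <= opnorm B.
Proof.
move=> BB'; have nB := opnorm_ge0 B; apply: opnorm_le => // x.
rewrite -ler_sqr ?nnegrE ?mulr_ge0 ?vnorm_ge0// -lecR -vnorm_inner.
exact: le_trans (ucp_Schwarz BB' x) (ucp_gram_le BB' x).
Qed.

Lemma ucp_multiplicative_defect Y B B' : self_adjoint Y -> is_adjoint B B' ->
  opnorm (phi (Y * B) - phi Y * phi B) ^+ 2 <=
  opnorm B ^+ 2 * opnorm (phi (Y * Y) - phi Y * phi Y).
Proof.
move=> Ysa BB'; set W := _ - _; set D := phi (Y * Y) - _.
have nB := opnorm_ge0 B; have nD := opnorm_ge0 D; have nW := opnorm_ge0 W.
have phiY := ucp_adjoint Ysa; have phiB' := ucp_adjoint (is_adjoint_sym BB').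
have AA' (i : 'I_3) : is_adjoint (nth 0 [:: 1; Y; B] i) (nth 0 [:: 1; Y; B'] i).
  by case: i => -[|[|[|]]].
(* Cauchy-Schwarz for the tensors B (x) b - 1 (x) phi(B) b and Y (x) a - 1 (x) phi(Y) a. Their
   pairing is <W b, a>, and the square of the second is <D a, a>. *)
have key b a : `|inner (W b) a| ^+ 2 <=
    ((opnorm B * vnorm b) ^+ 2 * (opnorm D * vnorm a ^+ 2))%:C.
  have := gram_form_CauchySchwarz AA' (fun i => nth 0 [:: - phi B b; 0; b] i)
    (fun i => nth 0 [:: - phi Y a; a; 0] i).
  rewrite /gram_form !big_ord_recl !big_ord0 /=.
  rewrite !mulr1 !mul1r phi_ucp.1 !bop_oneE !bop0 !bopN.
  rewrite !(linear0l, linear0r, linearNl, linearNr) /= !addr0 !add0r.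
  rewrite !opprK !subrr !add0r phiB' => h.
  have -> : inner (W b) a = - inner (phi Y (phi B b)) a + inner (phi (Y * B) b) a.
    by rewrite addrC -linearBl.
  apply: le_trans h _; rewrite rmorphM; apply: ler_pM.
  - by rewrite addrC subr_ge0 ucp_Schwarz.
  - by rewrite addrC subr_ge0 phiY ucp_Schwarz.
  - by rewrite -lerBrDl opprK (le_trans (ucp_gram_le BB' b))// lerDl inner_ge0.
  have s0 : 0 <= inner (D a) a by rewrite linearBl /= subr_ge0 phiY ucp_Schwarz.
  have -> : - inner (phi Y (phi Y a)) a + inner (phi (Y * Y) a) a = inner (D a) a.
    by rewrite addrC -linearBl.
  rewrite -[leLHS](ger0_norm s0) (le_trans (inner_CauchySchwarz _ _))// lecR.
  by rewrite expr2 mulrA ler_wpM2r ?vnorm_ge0 ?vnorm_opnorm.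
rewrite -[opnorm D]sqr_sqrtr// -exprMn ler_sqr ?nnegrE ?mulr_ge0 ?sqrtr_ge0//.
apply: opnorm_le => [|b]; first by rewrite mulr_ge0 ?sqrtr_ge0.
(* The choice [a = W b] in [key] puts |W b|^4 on the left and |W b|^2 on the right, so one factor |W
   b|^2 has to be cancelled. *)
have [->|Wb0] := eqVneq (W b) 0.
  by rewrite vnorm0 !mulr_ge0 ?sqrtr_ge0 ?vnorm_ge0.
have Wb_gt0 : 0 < vnorm (W b) ^+ 2 by rewrite exprn_gt0 ?vnorm_gt0.
rewrite -ler_sqr ?nnegrE ?mulr_ge0 ?sqrtr_ge0 ?vnorm_ge0//.
rewrite -(ler_pM2r Wb_gt0); have := key b (W b).
rewrite vnorm_inner ger0_norm ?ler0c ?sqr_ge0// -rmorphXn lecR.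
rewrite [X in X <= _ -> _]expr2 => /le_trans; apply.
by rewrite !exprMn sqr_sqrtr// [leRHS](_ : _ =
  opnorm B ^+ 2 * vnorm b ^+ 2 * (opnorm D * vnorm (W b) ^+ 2))//; ring.
Qed.

End UCPMaps.

(** * Asymptotic multiplicativity *)

Section NullSequences.
Context {R : realType} {K : hilbertSpace R}.
Implicit Types u v : nat -> bop K.

Definition op_null u := opnorm (u n) @[n --> \oo] --> (0 : R).

Lemma op_null_le u (c : R^nat) :
  (forall n, opnorm (u n) <= c n) -> c n @[n --> \oo] --> (0 : R) -> op_null u.
Proof.
move=> uc c0; apply: (squeeze_cvgr _ (cvg_cst 0) c0).
by apply: nearW => n; rewrite opnorm_ge0 uc.
Qed.

Lemma op_nullD u v : op_null u -> op_null v -> op_null (fun n => u n + v n).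
Proof.
move=> u0 v0; apply: (op_null_le (fun n => opnormD (u n) (v n))).
by rewrite -[X in _ --> X](addr0 0); exact: cvgD u0 v0.
Qed.

Lemma op_null_bound u v (c : R) :
  (forall n, opnorm (u n) <= c * opnorm (v n)) -> op_null v -> op_null u.
Proof.
move=> uv v0; apply: (op_null_le uv).
by rewrite -[X in _ --> X](mulr0 c); apply: cvgM v0; exact: cvg_cst.
Qed.

Lemma op_null_approx u :
  (forall e : R, 0 < e ->
    exists2 v, op_null v & forall n, opnorm (u n) <= opnorm (v n) + e) ->
  op_null u.
Proof.
move=> uv; apply/cvgrPdist_le => e e0.
have e20 : 0 < e / 2 by rewrite divr_gt0.
have [v /cvgrPdist_le/(_ _ e20) v0 uve] := uv _ e20.
near=> n; rewrite sub0r normrN ger0_norm ?opnorm_ge0// (le_trans (uve n))//.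
rewrite [leRHS]splitr lerD2r.
have : `|0 - opnorm (v n)| <= e / 2 by near: n.
by rewrite sub0r normrN ger0_norm ?opnorm_ge0.
Unshelve. all: by end_near. Qed.

End NullSequences.

Section AsymptoticMultiplicativity.
Context {R : realType} {H K : hilbertSpace R}.
Variables (A : set (bop H)) (pi : bop H -> bop K).
Variable phi : nat -> {linear bop K -> bop K}.
Hypothesis A_star : star_subalgebra A.
Hypothesis A_closed : norm_closed A.
Hypothesis A_adj : forall T, A T -> exists S, is_adjoint T S.
Hypothesis pi_rep : representation A pi.
Hypothesis phi_ucp : forall n, ucp (phi n).
Local Open Scope complex_scope.

(** [B] comes with an adjoint because the Gram form, and hence the bound of phi_n(B) by the norm of
    [B], requires one. *)
Definition asym_mult (T : bop K) := forall B B' : bop K, is_adjoint B B' ->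
  op_null (fun n => phi n (T * B) - T * phi n B).

Lemma asym_mult0 : asym_mult 0.
Proof.
move=> B B' _; apply: (op_null_bound (v := fun=> 0) (c := 0)) => [n|].
  by rewrite mul0r linear0 mul0r subr0 opnorm0 mul0r.
by rewrite /op_null opnorm0; exact: cvg_cst.
Qed.

Lemma asym_multD S T : asym_mult S -> asym_mult T -> asym_mult (S + T).
Proof.
move=> aS aT B B' BB'; have := op_nullD (aS _ _ BB') (aT _ _ BB').
by congr op_null; apply/funext => n; rewrite !mulrDl linearD opprD addrACA.
Qed.

Lemma asym_multZ (a : R[i]) T : asym_mult T -> asym_mult (a *: T).
Proof.
move=> aT B B' BB'; apply: (op_null_bound _ (aT _ _ BB')) => n.
by rewrite !bop_scaleAl linearZ -scalerBr; exact: opnormZ.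
Qed.

(** [S] is applied to [T * B], which is adjointable thanks to [T']; the remaining error is [S] times
    the error of [T] at [B]. *)
Lemma asym_multM S T T' : is_adjoint T T' ->
  asym_mult S -> asym_mult T -> asym_mult (S * T).
Proof.
move=> TT' aS aT B B' BB'.
have aTS : op_null (fun n => S * (phi n (T * B) - T * phi n B)).
  by apply: (op_null_bound _ (aT _ _ BB')) => n; exact: opnormM.
have := op_nullD (aS _ _ (is_adjointM TT' BB')) aTS.
by congr op_null; apply/funext => n; rewrite mulrBr addrA subrK !mulrA.
Qed.

(** Replacing [T] by [S] changes the error by at most 2 |pi(S - T)| |B|, uniformly in [n], since
    each phi_n is contractive on adjointable operators. *)
Lemma asym_mult_lim T : A T ->
  (forall c : R, 0 < c -> exists S,
    [/\ A S, asym_mult (pi S) & opnorm (S - T) <= c]) ->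
  asym_mult (pi T).
Proof.
move=> AT limT B B' BB'; apply: op_null_approx => e e0.
have nB := opnorm_ge0 B.
(* The 4 is the 2 of [opnorm_representation] times the two error terms; the 1 covers [B = 0]. *)
have c0 : 0 < e / (4 * (opnorm B + 1)) by rewrite divr_gt0// mulr_gt0// ltr_wpDl.
have [S [AS aS ST]] := limT _ c0.
exists (fun n => phi n (pi S * B) - pi S * phi n B); first exact: aS BB'.
move=> n; have [piD piZ piM pistar] := pi_rep.
have [A0 AD AZ AM Astar] := A_star.
have AST : A (S - T) by exact: star_subalgebraB.
have piST := representationB A_star pi_rep AS AT.
have [D' DD'] := A_adj AST; have AD' := Astar _ _ AST DD'.
have nD := opnorm_representation A_star A_closed A_adj pi_rep AST c0 ST.
have phiB := ucp_contractive (phi_ucp n) BB'.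
have phiDB := ucp_contractive (phi_ucp n)
  (is_adjointM (pistar _ _ AST AD' DD') BB').
rewrite [X in opnorm X <= _](_ : _ = phi n (pi S * B) - pi S * phi n B +
  (pi (S - T) * phi n B - phi n (pi (S - T) * B))); last first.
  by rewrite piST !mulrBl linearB opprB [X in _ = _ + X]addrC [RHS]addrCA !subrKA.
rewrite (le_trans (opnormD _ _))// lerD2l (le_trans (opnormD _ _))// opnormN.
set d := opnorm (pi (S - T)) in nD.
have d0 : 0 <= d := opnorm_ge0 _.
apply: (@le_trans _ _ (d * opnorm B + d * opnorm B)).
  rewrite lerD//; first by rewrite (le_trans (opnormM _ _))// ler_wpM2l.
  by rewrite (le_trans phiDB)// opnormM.
rewrite -mulrDl -mulr2n -mulr_natl.
apply: (@le_trans _ _ (2 * (2 * (e / (4 * (opnorm B + 1)))) * opnorm B)).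
  by rewrite ler_wpM2r// ler_wpM2l.
rewrite [leLHS](_ : _ = e * opnorm B / (opnorm B + 1)); last first.
  by field; rewrite gt_eqF// ltr_wpDl.
by rewrite ler_pdivrMr ?ltr_wpDl// ler_wpM2l ?lerDl// ltW.
Qed.

Lemma asym_mult_generator Y : self_adjoint Y ->
  op_null (fun n => phi n Y - Y) -> op_null (fun n => phi n (Y * Y) - Y * Y) ->
  asym_mult Y.
Proof.
move=> Ysa phiY phiYY B B' BB'.
have phiYn n : opnorm (phi n Y) <= opnorm Y := ucp_contractive (phi_ucp n) Ysa.
have phiBn n : opnorm (phi n B) <= opnorm B := ucp_contractive (phi_ucp n) BB'.
(* Both phi_n(Y^2) and phi_n(Y)^2 tend to Y^2, the latter because the phi_n(Y) are bounded by the
   norm of [Y]. *)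
have defect : op_null (fun n => phi n (Y * Y) - phi n Y * phi n Y).
  have sqr : op_null (fun n => Y * Y - phi n Y * phi n Y).
    apply: (op_null_bound (c := opnorm Y + opnorm Y) _ phiY) => n.
    rewrite (le_trans (opnorm_sqrB _ _))// opnormBC ler_wpM2r ?opnorm_ge0//.
    by rewrite lerD2l.
  have := op_nullD phiYY sqr; congr op_null; apply/funext => n.
  by rewrite addrA subrK.
have mult : op_null (fun n => phi n (Y * B) - phi n Y * phi n B).
  apply: (op_null_le (c := fun n => opnorm B *
      Num.sqrt (opnorm (phi n (Y * Y) - phi n Y * phi n Y)))) => [n|].
    rewrite -ler_sqr ?nnegrE ?mulr_ge0 ?opnorm_ge0 ?sqrtr_ge0//.
    rewrite exprMn sqr_sqrtr ?opnorm_ge0//.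
    exact: (ucp_multiplicative_defect (phi_ucp n) Ysa BB').
  rewrite -[X in _ --> X](mulr0 (opnorm B)); apply: cvgM; first exact: cvg_cst.
  rewrite -(sqrtr0 R).
  by apply: continuous_cvg defect; exact: sqrt_continuous.
(* This exchanges phi_n(Y) for [Y] in the left factor. *)
have left_null : op_null (fun n => (phi n Y - Y) * phi n B).
  apply: (op_null_bound (c := opnorm B) _ phiY) => n.
  by rewrite (le_trans (opnormM _ _))// mulrC ler_wpM2r ?opnorm_ge0.
have := op_nullD mult left_null; congr op_null; apply/funext => n.
by rewrite mulrBl addrA subrK.
Qed.

Lemma asym_mult_cvg T : asym_mult T -> op_null (fun n => phi n T - T).
Proof.
move=> /(_ 1 1 (@is_adjoint1 _ _)); congr op_null; apply/funext => n.
by rewrite mulr1 (phi_ucp n).1 mulr1.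
Qed.

End AsymptoticMultiplicativity.

(** * Hyperrigidity of X and X^2 in the algebra generated by X *)

Lemma cstar_generated_adjoin (R : realType) (H : hilbertSpace R)
    (G G' : set (bop H)) : G `<=` G' -> G' `<=` cstar_generated G ->
  cstar_generated G' = cstar_generated G.
Proof.
move=> GG' G'A; apply/seteqP; split=> T AT.
  apply: AT; split=> //; split; first exact: star_subalgebra_generated.
  exact: norm_closed_generated.
by move=> B [BC BG]; apply: AT; split=> //; apply: subset_trans BG.
Qed.

Unset Implicit Arguments.

Theorem theorem1p2 (R : realType) (H : hilbertSpace R) (X : bop H)
    (hX : self_adjoint X) :
  hyperrigid_generator (cstar_generated [set X]) [set X; X ^+ 2].
Proof.
set A := cstar_generated [set X].
have A_star : star_subalgebra A by exact: star_subalgebra_generated.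
have A_closed : norm_closed A by exact: norm_closed_generated.
have A_adj : forall T, A T -> exists S, is_adjoint T S.
  by apply: adjointable_generated => _ ->.
have AX : A X by move=> B [_ BX]; exact: BX.
have [A0 AD AZ AM Astar] := A_star.
split.
- by apply: finite_set_countable; exact: finite_set2.
- apply: cstar_generated_adjoin => [T|T [] ->]; [by left|exact: AX|].
  by rewrite expr2; exact: AM.
move=> K pi pi_rep _ _ phi phi_ucp phi_cvg T AT.
have [piD piZ piM pistar] := pi_rep.
have pi0 : pi 0 = 0 by rewrite -(scale0r (0 : bop H)) piZ// scale0r.
have aX : asym_mult phi (pi X).
  apply: asym_mult_generator => //; first exact: pistar.
    by apply: phi_cvg; left.
  by rewrite -piM//; apply: phi_cvg; right.
apply: asym_mult_cvg => //.
(* Membership in [A] is included because [pi] is controlled only there; the clause on the adjoint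
   makes [S] closed under adjoints and supplies the adjoint used for products. *)
pose S := [set T | [/\ A T, asym_mult phi (pi T) &
  exists2 T', is_adjoint T T' & asym_mult phi (pi T')]].
suff : S T by case.

apply: (AT S); split; last by move=> _ ->; split=> //; exists X.
split.
  split.
  - by split=> //; [|exists 0; [exact: is_adjoint0|]];
      rewrite pi0; exact: asym_mult0.
  - move=> U V [AU aU [U' UU' aU']] [AV aV [V' VV' aV']].
    have AU' := Astar _ _ AU UU'; have AV' := Astar _ _ AV VV'.
    split; [exact: AD|by rewrite piD//; exact: asym_multD|].
    exists (U' + V'); first exact: is_adjointD.
    by rewrite piD//; exact: asym_multD.
  - move=> a U [AU aU [U' UU' aU']]; have AU' := Astar _ _ AU UU'.
    split; [exact: AZ|by rewrite piZ//; exact: asym_multZ|].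
    exists (Num.conj a *: U'); first exact: is_adjointZ.
    by rewrite piZ//; exact: asym_multZ.
  - move=> U V [AU aU [U' UU' aU']] [AV aV [V' VV' aV']].
    have AU' := Astar _ _ AU UU'; have AV' := Astar _ _ AV VV'.
    have piV := pistar _ _ AV AV' VV'; have piU := pistar _ _ AU AU' UU'.
    split; [exact: AM|by rewrite piM//; exact: asym_multM piV aU aV|].
    exists (V' * U'); first exact: is_adjointM.
    by rewrite piM//; exact: (asym_multM (is_adjoint_sym piU)).
  - move=> U V [AU aU [U' UU' aU']] UV.
    rewrite (is_adjoint_unique UV UU'); split=> //; first exact: Astar UU'.
    by exists U => //; exact: is_adjoint_sym.
move=> U cU.
have AU : A U.
  by apply: A_closed => e e0; have [V [AV _ _] VU] := cU e e0; exists V.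
have [U' UU'] := A_adj U AU.
split=> //.
  apply: (asym_mult_lim A_star) => // c c0; have [V [AV aV _] VU] := cU c c0.
  by exists V; split=> //; exact: ltW.
(* The adjoints [V'] approximate [U'] as well as the [V] approximate [U], by [opnorm_adjoint]. *)
exists U' => //; apply: (asym_mult_lim A_star) => //; first exact: Astar UU'.
move=> c c0; have [V [AV _ [V' VV' aV']] VU] := cU c c0.
exists V'; split=> //; first exact: Astar VV'.
apply: le_trans (ltW VU); apply: opnorm_adjoint.
exact: is_adjointB.
Qed.
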